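(* Let $n \geq 2$ and let $f:\mathbb{C}^n \to \mathbb{C}^n$ be a continuous mapping that preserves unit distance. Then $f$ has the form $I \circ (\rho,\ldots,\rho)$ ($n$ copies of $\rho$), where $\rho \in \{\mathrm{id}(\mathbb{C}),\tau\}$ and $I:\mathbb{C}^n \to \mathbb{C}^n$ is an affine mapping with orthogonal linear part.
   Context: Let $\varphi_n:\mathbb{C}^n\times\mathbb{C}^n\to\mathbb{C}$, $\varphi_n((x_1,\ldots,x_n),(y_1,\ldots,y_n))=\sum_{i=1}^n (x_i-y_i)^2$ (no complex conjugation). A mapping $f:\mathbb{C}^n\to\mathbb{C}^n$ preserves distance $d\in\mathbb{C}$ if for all $X,Y\in\mathbb{C}^n$, $\varphi_n(X,Y)=d^2$ implies $\varphi_n(f(X),f(Y))=d^2$; it preserves unit distance if it preserves distance $d=1$. $\tau:\mathbb{C}\to\mathbb{C}$ is complex conjugation, $\mathrm{id}(\mathbb{C})$ is the identity map of $\mathbb{C}$, and $(\rho,\ldots,\rho)$ denotes the map $(x_1,\ldots,x_n)\mapsto(\rho(x_1),\ldots,\rho(x_n))$. An affine mapping with orthogonal linear part is a map $X\mapsto LX+b$ with $b\in\mathbb{C}^n$ and $L$ a complex $n\times n$ matrix satisfying $L^{T}L=\mathrm{Id}$ (transpose without conjugation). *)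

(* Defs.v *)
From mathcomp Require Import all_boot all_order all_algebra.
From mathcomp Require Import all_classical all_reals all_analysis.
From mathcomp Require Import complex.

Set Implicit Arguments.
Unset Strict Implicit.
Unset Printing Implicit Defensive.

Import Order.TTheory GRing.Theory Num.Theory.
Import numFieldNormedType.Exports.

Local Open Scope ring_scope.

(* The cast to [numClosedFieldType] is what endows [R[i]] with the topology of
   its modulus (through [numFieldNormedType.Exports]); ['cV[C R]_n] then carries
   the product topology. *)
Definition C (R : realType) : numClosedFieldType := complex R.

Definition phi (R : realType) (n : nat) (X Y : 'cV[C R]_n) : C R :=
  \sum_(i < n) (X i 0 - Y i 0) ^+ 2.

Definition preserves_distance (R : realType) (n : nat) (d : C R)
    (f : 'cV[C R]_n -> 'cV[C R]_n) : Prop :=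
  forall X Y : 'cV[C R]_n, phi X Y = d ^+ 2 -> phi (f X) (f Y) = d ^+ 2.

Definition preserves_unit_distance (R : realType) (n : nat)
    (f : 'cV[C R]_n -> 'cV[C R]_n) : Prop :=
  preserves_distance 1 f.

Definition tau (R : realType) (z : C R) : C R := z^*.

Definition coordinatewise (R : realType) (n : nat) (rho : C R -> C R)
    (X : 'cV[C R]_n) : 'cV[C R]_n :=
  map_mx rho X.

Definition affine_orthogonal (R : realType) (n : nat)
    (I : 'cV[C R]_n -> 'cV[C R]_n) : Prop :=
  exists (L : 'M[C R]_n) (b : 'cV[C R]_n),
    L^T *m L = 1%:M /\ forall X : 'cV[C R]_n, I X = L *m X + b.

(* Main.v *)
Require Import Defs.
From mathcomp Require Import all_boot all_order all_algebra.
From mathcomp Require Import all_classical all_reals all_analysis.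
From mathcomp Require Import complex.
From mathcomp Require Import ring lra.

Set Implicit Arguments.
Unset Strict Implicit.
Unset Printing Implicit Defensive.

Import Order.TTheory GRing.Theory Num.Theory.
Import numFieldNormedType.Exports.

Local Open Scope ring_scope.

Local Notation "x %:K" := ((x%:C)%C : C _) (at level 2, format "x %:K").

(** Idea.  Let [P r] mean that every continuous map of C^n preserving unit distance preserves
    the squared distance [r].  Since the orthogonal group acts transitively on pairs of points
    at a given nonzero squared distance, [P r] can be checked on one pair; scaling makes [P]
    multiplicative, and [P] is closed in (0, +oo).

    Points at a fixed preserved distance from the vertices of an (n-2)-simplex with unit edges
    form a conic that is parametrized by C^*.  The image of this conic is again such a conic,
    and a chord of preserved length is turned into a multiplication by zeta or by 1/zeta in
    the parameter; by continuity the choice is constant, so the rotation by zeta can be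
    iterated and [P] holds for the chord of [k] successive steps.  Unit chords give
    [P (2 + 2 / n)]; hence arbitrarily large radii are available, and unit chords of such
    circles give [P (k ^ 2)] in the limit.  Five steps on a suitable circle give some
    [P (b ^ 2)] with [0 < b < 1].  The numbers [k * b ^ j] being dense, [P] holds on (0, +oo).

    Consequently, up to an orthogonal affine map, [f] fixes R^n.  If [y = a + i b] with [a],
    [b] real and [b <> 0], the real points [a + c] with [c] orthogonal to [b] and
    [|c|^2 = |b|^2 + 1] are at unit distance from [y] and are fixed; this leaves only
    [f y = y] and [f y = a - i b].  The set of non-real points is connected for n >= 2, so
    the same alternative holds everywhere. *)

(** * The bilinear form *)

Section BilinearForm.
Variables (K : numFieldType) (n : nat).
Implicit Types (u v w : 'cV[K]_n) (L U V : 'M[K]_n).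

Definition dot u v : K := (u^T *m v) 0 0.

Lemma dotE u v : dot u v = \sum_i u i 0 * v i 0.
Proof. by rewrite /dot mxE; apply: eq_bigr => i _; rewrite mxE. Qed.

Lemma dotC u v : dot u v = dot v u.
Proof. by rewrite !dotE; apply: eq_bigr => i _; rewrite mulrC. Qed.

Lemma dotDl u v w : dot (u + v) w = dot u w + dot v w.
Proof. by rewrite /dot linearD mulmxDl mxE. Qed.

Lemma dotNl u w : dot (- u) w = - dot u w.
Proof. by rewrite /dot linearN mulNmx mxE. Qed.

Lemma dotZl a u w : dot (a *: u) w = a * dot u w.
Proof. by rewrite /dot linearZ -scalemxAl mxE. Qed.

Lemma dotDr u v w : dot w (u + v) = dot w u + dot w v.
Proof. by rewrite dotC dotDl !(dotC w). Qed.

Lemma dotNr u w : dot w (- u) = - dot w u.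
Proof. by rewrite dotC dotNl dotC. Qed.

Lemma dotZr a u w : dot w (a *: u) = a * dot w u.
Proof. by rewrite dotC dotZl dotC. Qed.

Definition dot_lin := (dotDl, dotDr, dotNl, dotNr, dotZl, dotZr).

Lemma dot_orthogonal L u v : L^T *m L = 1%:M -> dot (L *m u) (L *m v) = dot u v.
Proof.
by move=> hL; rewrite /dot trmx_mul mulmxA -(mulmxA _ _ L) hL mulmx1.
Qed.

Definition householder w : 'M[K]_n :=
  1%:M - (2 / dot w w) *: (w *m w^T).

Lemma mul_householder w v :
  householder w *m v = v - (2 / dot w w * dot w v) *: w.
Proof.
rewrite mulmxBl mul1mx -scalemxAl -mulmxA [w^T *m v]mx11_scalar.
by rewrite mul_mx_scalar scalerA.
Qed.

Lemma householder_orthogonal w :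
  dot w w != 0 -> (householder w)^T *m householder w = 1%:M.
Proof.
move=> w0.
have -> : (householder w)^T = householder w.
  by rewrite /householder !linearB linearZ /= trmx1 trmx_mul trmxK.
rewrite {2}/householder mulmxBr mulmx1 -scalemxAr mulmxA mul_householder.
rewrite divfK // /householder.
rewrite mulmxBl -scalemxAl scalerBr scalerA.
apply/matrixP => i j; rewrite !mxE; field.
exact: w0.
Qed.

(** The reflection along [v - v'] works unless this vector is isotropic. By the parallelogram
    identity [v + v'] is then not isotropic, and the reflection along it sends [v] to [- v']. *)
Lemma exists_orthogonal_map v v' : dot v v != 0 -> dot v v = dot v' v' ->
  exists L, L^T *m L = 1%:M /\ L *m v = v'.
Proof.
move=> v0 vv'.
have [w0|w0] := eqVneq (dot (v - v') (v - v')) 0; last first.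
  exists (householder (v - v')); split; first exact: householder_orthogonal.
  rewrite mul_householder; set c := _ * _.
  suff -> : c = 1 by rewrite scale1r subKr.
  apply: (mulIf w0); rewrite /c; move: w0.
  rewrite !dot_lin -vv' (dotC v' v) => w0; field.
  by move: w0; congr (_ != _); ring.
have w1 : dot (v + v') (v + v') != 0.
  have -> : dot (v + v') (v + v') = 4 * dot v v - dot (v - v') (v - v').
    by rewrite !dot_lin -vv' (dotC v' v); ring.
  by rewrite w0 subr0 mulf_neq0 // pnatr_eq0.
exists (- householder (v + v')); split.
  by rewrite [X in X *m _]linearN mulNmx mulmxN opprK householder_orthogonal.
rewrite mulNmx mul_householder; set c := _ * _.
suff -> : c = 1 by rewrite scale1r opprB addrC addKr.
apply: (mulIf w1); rewrite /c; move: w1.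
rewrite !dot_lin -vv' (dotC v' v) => w1; field.
by move: w1; congr (_ != _); ring.
Qed.

(** The map is [U *m invmx V]; [V] is invertible because the common Gram matrix is. *)
Lemma gram_orthogonal U V : U \in unitmx -> U^T *m U = V^T *m V ->
  exists L, L^T *m L = 1%:M /\ L *m V = U.
Proof.
move=> uU UV.
have uV : V \in unitmx.
  have : V^T *m V \in unitmx by rewrite -UV unitmx_mul unitmx_tr uU.
  by rewrite unitmx_mul => /andP[].
exists (U *m invmx V); split; last by rewrite -mulmxA mulVmx // mulmx1.
rewrite trmx_mul mulmxA -(mulmxA _ U^T) UV trmx_inv mulmxA mulVmx ?unitmx_tr //.
by rewrite mul1mx mulmxV.
Qed.

(** Twice the Gram matrix of a unit simplex. As the all-ones matrix satisfies J^2 = n J, the inverse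
    is 1 - J / (n + 1). *)
Lemma id_plus_ones_unit : 1%:M + const_mx 1 \in @unitmx K n.
Proof.
pose J : 'M[K]_n := const_mx 1; rewrite -/J.
have JJ : J *m J = n%:R *: J.
  apply/matrixP => i j; rewrite !mxE (eq_bigr (fun => 1)).
    by rewrite sumr_const card_ord mulr1.
  by move=> k _; rewrite !mxE mulr1.
have : (1%:M + J) *m (1%:M - n.+1%:R^-1 *: J) = 1%:M.
  rewrite mulmxDl mul1mx mulmxBr mulmx1 -scalemxAr JJ.
  have n1 : n.+1%:R != 0 :> K by rewrite pnatr_eq0.
  rewrite scalerA -addrA -[RHS]addr0; congr (_ + _).
  rewrite -!scaleNr -{2}[J]scale1r -!scalerDl (_ : _ + _ = 0) ?scale0r //.
  by rewrite -natr1 in n1 *; rewrite /GRing.scale /=; field.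
by case/mulmx1_unit.
Qed.

End BilinearForm.

(** * Continuity of maps between spaces of matrices *)

Section Topology.
Local Open Scope classical_set_scope.

Lemma continuous_compose (S T U : topologicalType) (g : S -> T) (h : T -> U) :
  continuous g -> continuous h -> continuous (fun x => h (g x)).
Proof. by move=> gc hc x; apply: continuous_comp; [exact: gc|exact: hc]. Qed.

Lemma continuous_mx (S T : topologicalType) (m n : nat) (h : S -> 'M[T]_(m, n)) :
  (forall i j, continuous (fun x => h x i j)) -> continuous h.
Proof.
move=> hc x A [P nP PA]; apply: filterS; first exact: PA.
rewrite /=; apply: filter_forall => i; apply: filter_forall => j.
exact: (hc i j x _ (nP i j)).
Qed.

Lemma continuous_entry (T : topologicalType) (m n : nat) (i : 'I_m) (j : 'I_n) :
  continuous (fun M : 'M[T]_(m, n) => M i j).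
Proof.
move=> M A nA; exists (fun i' j' => if (i' == i) && (j' == j) then A else setT).
  move=> i' j'; case: ifP => [/andP[/eqP -> /eqP ->] //|_]; exact: filterT.
by move=> N /(_ i j) /=; rewrite !eqxx.
Qed.

Variable R : realType.

Lemma continuous_real_complex : continuous (fun x : R => (x%:C)%C : C R).
Proof.
move=> x A /nbhs_ballP[e /= e0 eA]; apply/nbhs_ballP.
(* A positive element of [C R] is real, so its real part can serve as radius. *)
exists (complex.Re e) => /=; first by move: e0; rewrite ltcE /= => /andP[].
move=> y xy; apply: eA; move: xy; rewrite /ball /= => xy.
rewrite -rmorphB normc_def /= expr0n /= addr0 sqrtr_sqr.
by move: e0 xy; rewrite !ltcE /= => /andP[/eqP <- _] ->; rewrite eqxx.
Qed.

Lemma continuous_Im : continuous (fun z : C R => complex.Im z).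
Proof.
move=> x A /nbhs_ballP[e /= e0 eA]; apply/nbhs_ballP.
exists (e%:C)%C => /=; first by rewrite ltcR.
move=> y xy; apply: eA; move: xy; rewrite /ball /= normc_def ltcR.
apply: le_lt_trans; rewrite -raddfB /= -sqrtr_sqr ler_wsqrtr //.
by rewrite lerDr sqr_ge0.
Qed.

Section PointwiseOperations.
Variables (S : topologicalType) (K : numFieldType).
Implicit Types g h : S -> K.

Lemma continuous_cst (c : K) : continuous (fun _ : S => c).
Proof. by move=> x; exact: cvg_cst. Qed.

Lemma continuous_add g h :
  continuous g -> continuous h -> continuous (fun x => g x + h x).
Proof. by move=> cg ch x; exact: (continuousD (cg x) (ch x)). Qed.

Lemma continuous_sub g h :
  continuous g -> continuous h -> continuous (fun x => g x - h x).
Proof. by move=> cg ch x; exact: (continuousB (cg x) (ch x)). Qed.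

Lemma continuous_mul g h :
  continuous g -> continuous h -> continuous (fun x => g x * h x).
Proof. by move=> cg ch x; exact: (continuousM (cg x) (ch x)). Qed.

Lemma continuous_inv g :
  (forall x, g x != 0) -> continuous g -> continuous (fun x => (g x)^-1).
Proof. by move=> g0 cg x; exact: (continuousV (g0 x) (cg x)). Qed.

Lemma continuous_sum (n : nat) (h : 'I_n -> S -> K) :
  (forall i, continuous (h i)) -> continuous (fun x => \sum_i h i x).
Proof.
by move=> hc; apply: continuous_big => //; exact: (@add_continuous K^o).
Qed.

End PointwiseOperations.

Lemma continuous_affine (K : numFieldType) (m n p : nat)
    (L : 'M[K]_(m, n)) (b : 'M[K]_(m, p)) :
  continuous (fun X : 'M[K]_(n, p) => L *m X + b).
Proof.
apply: continuous_mx => i j; under eq_fun do rewrite !mxE.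
apply: continuous_add; last exact: continuous_cst.
apply: continuous_sum => k; apply: continuous_mul; first exact: continuous_cst.
exact: continuous_entry.
Qed.

Lemma continuous_scale (K : numFieldType) (m n : nat) (c : K) :
  continuous (fun X : 'M[K]_(m, n) => c *: X).
Proof.
apply: continuous_mx => i j; under eq_fun do rewrite mxE.
apply: continuous_mul; first exact: continuous_cst.
exact: continuous_entry.
Qed.

End Topology.

(** * Preserved distances *)

Section PreservedDistances.
Variables (R : realType) (n : nat).
Implicit Types (X Y : 'cV[C R]_n) (f : 'cV[C R]_n -> 'cV[C R]_n).

Lemma phiE X Y : phi X Y = dot (X - Y) (X - Y).
Proof. by rewrite dotE; apply: eq_bigr => i _; rewrite !mxE expr2. Qed.

Lemma phi_affine (L : 'M[C R]_n) b X Y :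
  L^T *m L = 1%:M -> phi (L *m X + b) (L *m Y + b) = phi X Y.
Proof.
by move=> hL; rewrite !phiE opprD addrACA subrr addr0 -mulmxBr dot_orthogonal.
Qed.

(* [r] is the squared distance. *)
Definition always_preserved (r : R) : Prop :=
  forall f, continuous f -> preserves_unit_distance f ->
  forall X Y, phi X Y = r%:K -> phi (f X) (f Y) = r%:K.

Lemma always_preserved1 : always_preserved 1.
Proof. by move=> f _ fu X Y; move: (fu X Y); rewrite expr1n. Qed.

(** Precomposing [f] with an orthogonal affine map that carries [X0], [Y0] to [X], [Y] yields
    another admissible map, to which the hypothesis applies. *)
Lemma always_preserved_pair (r : R) X0 Y0 : r != 0 -> phi X0 Y0 = r%:K ->
  (forall f, continuous f -> preserves_unit_distance f ->
     phi (f X0) (f Y0) = r%:K) ->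
  always_preserved r.
Proof.
move=> r0 XY0 hf f fc fu X Y XY.
have [] := @exists_orthogonal_map _ _ (X0 - Y0) (X - Y).
- by rewrite -phiE XY0; apply: contra_neq r0 => -[].
- by rewrite -!phiE XY0 XY.
move=> L [hL LXY].
have := hf (fun Z => f (L *m Z + (X - L *m X0))).
have -> : L *m X0 + (X - L *m X0) = X by rewrite addrC subrK.
have -> : L *m Y0 + (X - L *m X0) = Y.
  by rewrite addrCA -mulmxBr -opprB mulmxN LXY subKr.
apply.
  by apply: continuous_compose fc; exact: continuous_affine.
by move=> Z W ZW; apply: fu; rewrite phi_affine.
Qed.

Lemma phi_scale (c : C R) X Y : phi (c *: X) (c *: Y) = c ^+ 2 * phi X Y.
Proof. by rewrite !phiE -scalerBr dotZl dotZr mulrA expr2. Qed.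

(** Conjugating [f] by the dilation of ratio [Num.sqrt a] gives a map that preserves unit distance
    because [f] preserves [a]; that this map preserves [b] means that [f] preserves [a * b]. *)
Lemma always_preserved_mul (a b : R) :
  0 < a -> always_preserved a -> always_preserved b -> always_preserved (a * b).
Proof.
move=> a0 Pa Pb f fc fu X Y XY.
set c : C R := (Num.sqrt a)%:K.
have c2 : c ^+ 2 = a%:K by rewrite -rmorphXn /= sqr_sqrtr // ltW.
have aK : a%:K != 0 by rewrite (_ : 0 = 0%:K) // (inj_eq (@complexI _)) gt_eqF.
have c0 : c != 0 by apply: contra_neq aK => c0; rewrite -c2 c0 expr0n.
pose g := fun Z => c^-1 *: f (c *: Z).
have gE Z : g (c^-1 *: Z) = c^-1 *: f Z by rewrite /g scalerA mulfV // scale1r.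
have gc : continuous g.
  apply: continuous_compose; last exact: continuous_scale.
  by apply: continuous_compose fc; exact: continuous_scale.
have gu : preserves_unit_distance g.
  move=> Z W; rewrite expr1n => ZW; rewrite phi_scale exprVn c2.
  rewrite (Pa f fc fu) ?mulVf // phi_scale c2 ZW.
  exact: mulr1.
have := Pb g gc gu (c^-1 *: X) (c^-1 *: Y).
rewrite !gE !phi_scale exprVn c2 XY.
rewrite (_ : (a * b)%:K = a%:K * b%:K); last exact: rmorphM.
rewrite mulKf // => /(_ erefl) <-.
by rewrite mulVKf.
Qed.

Lemma always_preserved_exp (a : R) k :
  0 < a -> always_preserved a -> always_preserved (a ^+ k).
Proof.
move=> a0 Pa; elim: k => [|k IH]; first exact: always_preserved1.
by rewrite exprS; apply: always_preserved_mul.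
Qed.

Lemma always_preserved_closed (r : R) : 0 < r ->
  (forall e, 0 < e -> exists r', [/\ 0 < r', `|r' - r| < e & always_preserved r']) ->
  always_preserved r.
Proof.
move=> r0 hr f fc fu X Y XY.
have rN0 : r != 0 by rewrite gt_eqF.
(* The point of parameter [c] on the line from [X] to [Y] has squared distance c^2 r from [X]. The
   defect [h] is continuous and vanishes whenever c^2 r is preserved; such [c] accumulate at 1. *)
pose h (c : R) : C R :=
  phi (f X) (f (X + c%:K *: (Y - X))) - c%:K * c%:K * r%:K.
have hc : continuous h.
  have pc : continuous (fun c : R => f (X + c%:K *: (Y - X))).
    apply: continuous_compose fc.
    apply: continuous_mx => i j; under eq_fun do rewrite !mxE.
    apply: continuous_add; first exact: continuous_cst.
    by apply: continuous_mul; [exact: continuous_real_complex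
                              |exact: continuous_cst].
  apply: continuous_sub; last first.
    apply: continuous_mul; last exact: continuous_cst.
    by apply: continuous_mul; exact: continuous_real_complex.
  apply: continuous_sum => i; rewrite /=.
  have hi : continuous (fun c : R => f X i 0 - f (X + c%:K *: (Y - X)) i 0).
    apply: continuous_sub; first exact: continuous_cst.
    exact: continuous_compose pc (@continuous_entry _ _ _ _ _).
  under eq_fun do rewrite expr2.
  exact: continuous_mul.
suff : h 1 = 0.
  rewrite /h (_ : 1%:K = 1) // scale1r (addrC X) subrK !mul1r => /eqP.
  by rewrite subr_eq0 => /eqP.
apply/eqP/negPn/negP => h1.
have /nbhs_ballP[e /= e0 he] : nbhs (1 : R) [set c : R | h c != 0]%classic.
  have : nbhs (h 1) [set z : C R | z != 0]%classic.
    apply/nbhs_ballP; exists `|h 1|; first by rewrite /= normr_gt0.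
    by move=> z; rewrite /ball /=; apply: contraTneq => ->; rewrite subr0 ltxx.
  exact: (hc 1).
(* For c^2 = r' / r and c >= 0, |c - 1| <= |c^2 - 1| = |r' - r| / r, which explains the
   tolerance. *)
have [r' [r'0 r're Pr']] := hr (e * r) (mulr_gt0 e0 r0).
set c := Num.sqrt (r' / r).
have c2 : c ^+ 2 = r' / r by rewrite sqr_sqrtr // ltW // divr_gt0.
have : h c != 0.
  apply: he; rewrite /ball /= distrC.
  have c0 : 0 <= c by exact: sqrtr_ge0.
  have h2 : `|c - 1| * (c + 1) * r < e * r.
    have -> : `|c - 1| * (c + 1) * r = `|(c - 1) * (c + 1) * r|.
      by rewrite !normrM (ger0_norm (addr_ge0 c0 ler01)) (gtr0_norm r0).
    by rewrite -subr_sqr expr1n c2 mulrBl divfK ?gt_eqF // mul1r.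
  move: h2; rewrite ltr_pM2r //; apply: le_lt_trans.
  by rewrite ler_peMr // lerDr.
rewrite /h -!rmorphM /= -expr2 c2 divfK ?rN0 // (Pr' f fc fu) ?subrr ?eqxx //.
rewrite phiE opprD addrA subrr add0r dotNr dotNl opprK dotZl dotZr.
rewrite -opprB dotNr dotNl opprK -phiE XY -!rmorphM /= mulrA -expr2 c2.
by rewrite divfK.
Qed.
End PreservedDistances.

(** * Simplices with unit edges and their congruence *)

Section UnitSimplex.
Variables (R : realType) (n : nat).
Implicit Types (p : 'I_n -> 'cV[C R]_n) (o : 'cV[C R]_n).

Definition unit_simplex p o :=
  (forall i, phi (p i) o = 1) /\ (forall i j, i != j -> phi (p i) (p j) = 1).

Definition edge_matrix p o : 'M[C R]_n := \matrix_(i, j) (p j - o) i 0.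

Lemma edge_matrix_gram p o i j :
  ((edge_matrix p o)^T *m edge_matrix p o) i j = dot (p i - o) (p j - o).
Proof. by rewrite mxE dotE; apply: eq_bigr => k _; rewrite !mxE. Qed.

Lemma phi_polar (x y o : 'cV[C R]_n) :
  2 * dot (x - o) (y - o) = phi x o + phi y o - phi x y.
Proof.
have -> : phi x y = dot (x - o - (y - o)) (x - o - (y - o)).
  by rewrite phiE opprB addrA subrK.
rewrite !phiE; move: (x - o) (y - o) => u v.
by rewrite !(dotDl, dotDr, dotNl, dotNr) (dotC v u); ring.
Qed.

Lemma unit_simplex_gram p o : unit_simplex p o ->
  (edge_matrix p o)^T *m edge_matrix p o = 2^-1 *: (1%:M + const_mx 1).
Proof.
move=> [po pp]; apply/matrixP => i j; rewrite edge_matrix_gram !mxE.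
have two : (2 : C R) != 0 by rewrite pnatr_eq0.
apply: (mulfI two); rewrite phi_polar !po mulVKf //.
have [->|ij] := eqVneq i j; last by rewrite pp //=; ring.
by rewrite phiE subrr dotE big1 ?subr0 // => k _; rewrite mxE mul0r.
Qed.

Lemma unit_simplex_edges_unit p o : unit_simplex p o -> edge_matrix p o \in unitmx.
Proof.
move=> /unit_simplex_gram E.
suff : 2^-1 *: (1%:M + const_mx 1) \in @unitmx (C R) n.
  by rewrite -E unitmx_mul => /andP[].
rewrite unitmxZ ?unitfE ?invr_eq0 ?pnatr_eq0 //.
exact: id_plus_ones_unit.
Qed.

(** All unit simplices have the same Gram matrix of edges at the apex, so the edges correspond under
    an orthogonal map; a translation then matches the apices. *)
Lemma unit_simplex_congruent p o p' o' : unit_simplex p o -> unit_simplex p' o' ->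
  exists (L : 'M[C R]_n) b, L^T *m L = 1%:M /\ forall i, L *m p' i + b = p i.
Proof.
move=> s s'.
have [|L [hL LM]] :=
  gram_orthogonal (V := edge_matrix p' o') (unit_simplex_edges_unit s).
  by rewrite !unit_simplex_gram.
exists L, (o - L *m o'); split=> // i.
have : col i (L *m edge_matrix p' o') = col i (edge_matrix p o) by rewrite LM.
have cE q c : col i (edge_matrix q c) = q i - c.
  by apply/matrixP => k l; rewrite !mxE (ord1 l).
rewrite {1}colE -mulmxA -colE !cE mulmxBr => LE.
by rewrite addrCA LE addrC subrK.
Qed.

End UnitSimplex.

(** The intermediate value theorem, in the form that makes a choice between two alternatives
    constant along a path. *)
Lemma nonvanishing_sign (R : realType) (h : R -> R) : continuous h ->
  (forall t, 0 <= t <= 1 -> h t != 0) -> (0 < h 0) = (0 < h 1).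
Proof.
move=> hc h0.
have ivt : ~~ (Num.min (h 0) (h 1) <= 0 <= Num.max (h 0) (h 1)).
  apply/negP => H; have [|c] := @IVT R h 0 1 0 ler01 _ H.
    exact: continuous_subspaceT.
  by rewrite in_itv => /= /h0 /eqP.
have := h0 0; have := h0 1; rewrite !lexx !ler01 => /(_ isT) h1 /(_ isT) h00.
move: ivt; rewrite ge_min le_max !leNgt.
have [a|a|a] := ltgtP (h 0) 0; have [b|b|b] := ltgtP (h 1) 0 => //=.
Qed.

(** * Isotropic coordinates on the circles around a simplex *)

Section CircleCoordinates.
Variables (K : numFieldType) (m : nat) (kap nu im : K).
Hypotheses (kap2 : kap ^+ 2 = 2^-1) (nu2 : nu ^+ 2 = m.+1%:R)
  (im2 : im ^+ 2 = -1).
Implicit Types (z : 'cV[K]_m.+2) (i : 'I_m.+1).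

(** The formula of [phi] over a general field; over [C R] the two are convertible. *)
Definition sqdist (n : nat) (X Y : 'cV[K]_n) : K :=
  \sum_i (X i 0 - Y i 0) ^+ 2.

(** Since [kap ^+ 2 = 2^-1], distinct vertices are at squared distance 1. *)
Definition vertex (n : nat) (j : 'I_n) : 'cV[K]_n := kap *: delta_mx j 0.

(** Only m + 1 of the m + 2 vertices are used: they span dimension m and leave a plane orthogonal to
    them. *)
Definition axis i : 'cV[K]_m.+2 := vertex (widen_ord (leqnSn _) i).

(* [w] and [w'] are isotropic coordinates on the plane orthogonal to the axis, so
   that the circles around the axis are the conics [w * w' = const]. *)
Definition circle_point (w w' : K) : 'cV[K]_m.+2 :=
  \col_j (if j == ord_max then (w - w') / (2 * im)
          else kap / m.+1%:R + (w + w') / (2 * nu)).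

(** These two functions recover [w] and [w'] from [circle_point w w']. The number [kap / m.+1%:R] is
    the common coordinate of the barycentre of the axis. *)
Definition coord_plus z : K := nu * (z ord0 0 - kap / m.+1%:R) + im * z ord_max 0.
Definition coord_minus z : K := nu * (z ord0 0 - kap / m.+1%:R) - im * z ord_max 0.

Let N0 : m.+1%:R != 0 :> K. Proof. by rewrite pnatr_eq0. Qed.
Let nu0 : nu != 0.
Proof. by apply: contra_neq N0 => nu0; rewrite -nu2 nu0 expr0n. Qed.
Let im0 : im != 0.
Proof.
by apply/eqP => im0; move/eqP: im2; rewrite im0 expr0n eq_sym oppr_eq0 oner_eq0.
Qed.
Let two0 : 2 != 0 :> K. Proof. by rewrite pnatr_eq0. Qed.

Lemma widen_neq_max i : (widen_ord (leqnSn _) i == ord_max :> 'I_m.+2) = false.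
Proof. by rewrite -val_eqE /= ltn_eqF. Qed.

Lemma sqdist_vertex (n : nat) (X : 'cV[K]_n) j :
  sqdist X (vertex j) = \sum_k X k 0 ^+ 2 - 2 * kap * X j 0 + 2^-1.
Proof.
rewrite /sqdist (bigD1 j) //= [in RHS](bigD1 j) //= !mxE !eqxx mulr1.
rewrite sqrrB kap2 (eq_bigr (fun k => X k 0 ^+ 2)); first by ring.
by move=> k kj; rewrite !mxE (negPf kj) mulr0 subr0.
Qed.

Lemma circle_point_widen w w' i :
  circle_point w w' (widen_ord (leqnSn _) i) 0 =
  kap / m.+1%:R + (w + w') / (2 * nu).
Proof. by rewrite mxE widen_neq_max. Qed.

Lemma circle_point_max w w' :
  circle_point w w' ord_max 0 = (w - w') / (2 * im).
Proof. by rewrite mxE eqxx. Qed.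

Lemma sqdist_circle_point w w' v v' :
  sqdist (circle_point w w') (circle_point v v') = (w - v) * (w' - v').
Proof.
rewrite /sqdist big_ord_recr /= !circle_point_max.
under eq_bigr do rewrite !circle_point_widen.
rewrite sumr_const card_ord -[X in X + _]mulr_natr -nu2.
have -> : (w - v) * (w' - v') = (w + w' - (v + v')) ^+ 2 / 4
     - (w - w' - (v - v')) ^+ 2 / 4 by field.
rewrite [X in _ = _ + X](_ : _ = (w - w' - (v - v')) ^+ 2 / (4 * im ^+ 2)).
  by field; rewrite nu0 im0.
by rewrite im2; field.
Qed.

(** Pythagoras: [w * w'] is the squared distance to the barycentre of the axis, and the constant is
    the squared circumradius of the axis. *)
Lemma sqdist_circle_point_axis w w' i :
  sqdist (circle_point w w') (axis i) = w * w' + (2^-1 - (2 * m.+1%:R)^-1).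
Proof.
rewrite sqdist_vertex circle_point_widen big_ord_recr /= circle_point_max.
under eq_bigr do rewrite !circle_point_widen.
rewrite sumr_const card_ord -[X in X + _ - _ + _ = _]mulr_natr -nu2.
have -> : 2^-1 = kap ^+ 2 by [].
have -> : w * w' = (w + w') ^+ 2 / 4 - (w - w') ^+ 2 / 4 by field.
rewrite [X in _ = _ + X + _](_ : _ = (w - w') ^+ 2 / (4 * im ^+ 2)); last first.
  by rewrite im2; field.
rewrite [X in _ = _ + (_ - X)](_ : _ = kap ^+ 2 / nu ^+ 2); last first.
  by rewrite kap2; field.
by field; rewrite nu0 im0.
Qed.

(** Subtracting two of the equations leaves a linear one, so equidistance from the axis makes the
    first m + 1 coordinates of [z] equal. *)
Lemma circle_point_coords z d : (forall i, sqdist z (axis i) = d) ->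
  z = circle_point (coord_plus z) (coord_minus z).
Proof.
move=> zd.
have zE i : z (widen_ord (leqnSn _) i) 0 = z ord0 0.
  have : sqdist z (axis i) = sqdist z (axis ord0) by rewrite !zd.
  rewrite !sqdist_vertex => /addIr /addrI /oppr_inj.
  have k0 : kap != 0.
    by apply/eqP => k0; move/eqP: kap2; rewrite k0 expr0n eq_sym invr_eq0 (negPf two0).
  move=> /(mulfI (mulf_neq0 two0 k0)) ->.
  by congr (z _ _); apply: val_inj.
apply/matrixP => j l; rewrite (ord1 l) mxE /coord_plus /coord_minus.
case: (eqVneq j ord_max) => [->|jmax].
  by field; rewrite im0 nat1r.
have jm : (j < m.+1)%N.
  by rewrite ltn_neqAle -ltnS ltn_ord andbT.
rewrite -(zE (Ordinal jm)); have -> : widen_ord (leqnSn m.+1) (Ordinal jm) = j.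
  exact: val_inj.
by field; rewrite nu0 nat1r.
Qed.

End CircleCoordinates.

(** * Rotations along a circle *)

Section SimplexNormalization.
Variables (R : realType) (n : nat).
Hypothesis n0 : (0 < n)%N.

Local Notation vtx := (@vertex _ (sqrtC (2^-1 : C R)) n).

Lemma standard_unit_simplex :
  exists c, @unit_simplex R n vtx c.
Proof.
set kap := sqrtC (2^-1 : C R).
have kap2 : kap ^+ 2 = 2^-1 by rewrite sqrtCK.
have nN0 : n%:R != 0 :> C R by rewrite pnatr_eq0 -lt0n.
pose mu : C R := sqrtC (2^-1 + n%:R / 2).
have mu2 : mu ^+ 2 = 2^-1 + n%:R / 2 by rewrite sqrtCK.
(* A root of n lam^2 - 2 kap lam + 1/2 = 1, which puts the apex [const_mx lam] at unit distance from
   every vertex. *)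
pose lam := (kap + mu) / n%:R.
have two0 : (2 : C R) != 0 by rewrite pnatr_eq0.
exists (const_mx lam); split => [i|i j ij].
  have -> : phi (vertex kap i) (const_mx lam) = sqdist (const_mx lam) (vertex kap i).
    by apply: eq_bigr => k _; rewrite -sqrrN opprB.
  rewrite sqdist_vertex // (eq_bigr (fun => lam ^+ 2)); last by move=> k _; rewrite mxE.
  rewrite sumr_const card_ord mxE -[X in X - _]mulr_natr.
  have : n%:R * (lam ^+ 2 * n%:R - 2 * kap * lam + kap ^+ 2) = n%:R * 1.
    have -> : n%:R * (lam ^+ 2 * n%:R - 2 * kap * lam + kap ^+ 2) =
      mu ^+ 2 - kap ^+ 2 + n%:R * kap ^+ 2 by rewrite /lam; field.
    by rewrite mu2 kap2; field.
  by move/(mulfI nN0); rewrite kap2.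
rewrite [LHS](@sqdist_vertex _ kap kap2) (bigD1 i) //= big1; last first.
  by move=> k ki; rewrite !mxE (negPf ki) mulr0 expr0n.
rewrite !mxE !eqxx (eq_sym j) (negPf ij) !mulr1 !mulr0 addr0 subr0 kap2.
by field.
Qed.

(** A motion after [f] brings the image of the standard simplex back in place. Distances between
    images do not change, so what is proved for [g] transfers to [f]. *)
Lemma fix_unit_simplex (f : 'cV[C R]_n -> 'cV[C R]_n) :
  continuous f -> preserves_unit_distance f ->
  exists g : 'cV[C R]_n -> 'cV[C R]_n,
    [/\ continuous g, preserves_unit_distance g,
        forall X Y, phi (g X) (g Y) = phi (f X) (f Y) &
        forall j, g (vtx j) = vtx j].
Proof.
move=> fc fu; have [c [vo vv]] := standard_unit_simplex.
have sf : unit_simplex (fun j => f (vtx j)) (f c).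
  by split=> [i|i j ij]; rewrite fu expr1n ?vo ?vv.
have [L [b [hL Lf]]] := unit_simplex_congruent (conj vo vv) sf.
have gphi X Y : phi (L *m f X + b) (L *m f Y + b) = phi (f X) (f Y).
  exact: phi_affine.
exists (fun X => L *m f X + b); split.
- exact: continuous_compose fc (@continuous_affine _ _ _ _ L b).
- by move=> X Y XY; rewrite gphi; exact: fu.
- exact: gphi.
- exact: Lf.
Qed.

End SimplexNormalization.

(** The products [a * b'] and [b * a'] have sum s (z + z') and product s^2, hence are the roots s z
    and s z' of one quadratic. *)
Lemma mul_conj_cases (K : fieldType) (a a' b b' s z z' : K) :
  a * a' = s -> b * b' = s -> z * z' = 1 ->
  (a - b) * (a' - b') = s * (2 - (z + z')) -> a * b' = s * z \/ a * b' = s * z'.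
Proof.
move=> as' bs zz ab.
have QE : b * a' = s * (z + z') - a * b'.
  apply: (addrI (- (a * a' + b * b'))); rewrite {2}as' {2}bs.
  have -> : - (a * a' + b * b') + b * a' = - ((a - b) * (a' - b')) - a * b' by ring.
  by rewrite ab; ring.
have : (a * b' - s * z) * (a * b' - s * z') = 0.
  have -> : (a * b' - s * z) * (a * b' - s * z') =
    s * s * (z * z') - a * b' * (s * (z + z') - a * b') by ring.
  by rewrite -QE zz -{1}as' -bs; ring.
by move/eqP; rewrite mulf_eq0 !subr_eq0 => /orP[]/eqP; [left|right].
Qed.

Lemma constant_of_succ (T : Type) (g : nat -> T) :
  (forall j, g j = g j.+1) -> forall j, g j = g 0%N.
Proof. by move=> gS; elim=> // j <-. Qed.

Section Circle.
Variables (R : realType) (m : nat) (d t rho2 x y : R).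
Hypotheses (Pd : @always_preserved R m.+2 d) (Pt : @always_preserved R m.+2 t).
Hypothesis rho2E : rho2 = d - 2^-1 + (2 * m.+1%:R)^-1.
Hypothesis rho2_gt0 : 0 < rho2.
Hypothesis xy1 : x ^+ 2 + y ^+ 2 = 1.
Hypothesis y0 : y != 0.
Hypothesis tE : t = rho2 * (2 - 2 * x).

(** A unit complex number. The circle has squared radius [rho2] and squared distance [d] from the
    vertices of the axis; multiplying the parameter by [zeta] moves a point along a chord of squared
    length [t]. *)
Let zeta : C R := (x +i* y)%C.
Let zeta' : C R := (x -i* y)%C.
Let kap := sqrtC (2^-1 : C R).
Let nu := sqrtC (m.+1%:R : C R).
Let im : C R := 'i.
Let rho := sqrtC (rho2%:K).

Let kap2 : kap ^+ 2 = 2^-1. Proof. exact: sqrtCK. Qed.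
Let nu2 : nu ^+ 2 = m.+1%:R. Proof. exact: sqrtCK. Qed.
Let im2 : im ^+ 2 = -1. Proof. exact: sqrCi. Qed.
Let rhoK : rho * rho = rho2%:K. Proof. by rewrite -expr2 sqrtCK. Qed.
Let rho2_neq0 : rho2%:K != 0.
Proof. by rewrite (_ : 0 = 0%:K) // (inj_eq (@complexI _)) gt_eqF. Qed.

Let twoK : 2%:K = 2 :> C R.
Proof. exact: (rmorph_nat (real_complex R) 2). Qed.

Let zetaK : zeta * zeta' = 1.
Proof.
rewrite /zeta /zeta'; apply/eqP; rewrite eq_complex /=.
rewrite mulrN opprK -!expr2 xy1 eqxx /=.
by apply/eqP; ring.
Qed.

Let zetaD : zeta + zeta' = (2 * x)%:K.
Proof.
apply/eqP; rewrite /zeta /zeta' eq_complex /= subrr eqxx andbT.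
by apply/eqP; ring.
Qed.

Let zeta0 : zeta != 0.
Proof.
apply: contraTneq isT => z0; move: zetaK; rewrite z0 mul0r => /eqP.
by rewrite eq_sym oner_eq0.
Qed.

Let zetaV : zeta^-1 = zeta'.
Proof. by apply: (mulfI zeta0); rewrite mulfV // zetaK. Qed.

Let pt (u : C R) : 'cV[C R]_m.+2 := circle_point m kap nu im (rho * u) (rho * u^-1).

Let phi_pt u v : phi (pt u) (pt v) = rho2%:K * ((u - v) * (u^-1 - v^-1)).
Proof.
rewrite [LHS]sqdist_circle_point // -rhoK.
by ring.
Qed.

Let dE : rho2%:K + (2^-1 - (2 * m.+1%:R)^-1) = d%:K.
Proof.
have -> : d = rho2 + (2^-1 - (2 * m.+1%:R)^-1) by rewrite rho2E; ring.
by rewrite !(rmorphD, rmorphN) /= !fmorphV rmorphM /= !rmorph_nat.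
Qed.

Let phi_pt_axis u i : u != 0 -> phi (pt u) (axis kap i) = d%:K.
Proof.
move=> u0; rewrite [LHS]sqdist_circle_point_axis // -dE -rhoK.
by rewrite mulrACA mulfV // mulr1.
Qed.

Section Image.
Variable f : 'cV[C R]_m.+2 -> 'cV[C R]_m.+2.
Hypotheses (fc : continuous f) (fu : preserves_unit_distance f).
Hypothesis fv : forall j, f (vertex kap j) = vertex kap j.

Let W u := coord_plus kap nu im (f (pt u)).
Let W' u := coord_minus kap nu im (f (pt u)).

Let f_pt_axis u i : u != 0 -> sqdist (f (pt u)) (axis kap i) = d%:K.
Proof.
move=> u0; rewrite -(Pd fc fu (phi_pt_axis i u0)) /axis fv.
exact: erefl.
Qed.

Let f_pt u : u != 0 -> f (pt u) = circle_point m kap nu im (W u) (W' u).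
Proof.
by move=> u0; apply: (@circle_point_coords _ _ _ _ _ kap2 nu2 im2 _ d%:K) => i;
  exact: f_pt_axis.
Qed.

Let WW' u : u != 0 -> W u * W' u = rho2%:K.
Proof.
move=> u0; apply: (addIr (2^-1 - (2 * m.+1%:R)^-1)).
rewrite -(sqdist_circle_point_axis kap2 nu2 im2 _ _ ord0) -f_pt // f_pt_axis //.
Qed.

Let phi_f_pt u v : u != 0 -> v != 0 ->
  phi (f (pt u)) (f (pt v)) = (W u - W v) * (W' u - W' v).
Proof.
by move=> u0 v0; rewrite (f_pt u0) (f_pt v0) [LHS]sqdist_circle_point.
Qed.

(** The chord from [pt u] to [pt (zeta * u)] has the preserved length [t], and both images lie on
    the same conic. As [W u * W' u] is [rho2], [W] is multiplied by [zeta] or by its inverse. *)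
Let step u : u != 0 ->
  W (zeta * u) * W' u = rho2%:K * zeta \/ W (zeta * u) * W' u = rho2%:K * zeta'.
Proof.
move=> u0; have zu0 : zeta * u != 0 by rewrite mulf_neq0.
have hphi : phi (pt (zeta * u)) (pt u) = t%:K.
  rewrite phi_pt invfM zetaV -{2}[u]mul1r -{2}[u^-1]mul1r -!mulrBl.
  rewrite mulrACA mulfV // mulr1 tE rmorphM rmorphB /= -zetaD.
  congr (_ * _); rewrite mulrBl !mulrBr zetaK mul1r !mulr1 twoK.
  by ring.
have := Pt fc fu hphi; rewrite phi_f_pt // tE rmorphM rmorphB /= -zetaD twoK.
exact: mul_conj_cases (WW' zu0) (WW' u0) zetaK.
Qed.

Let continuous_pt (u : R -> C R) :
  continuous u -> (forall s, u s != 0) -> continuous (fun s => pt (u s)).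
Proof.
move=> uc u0; apply: continuous_mx => i j; under eq_fun do rewrite mxE.
have wc : continuous (fun s => rho * u s).
  by apply: continuous_mul uc; exact: continuous_cst.
have wc' : continuous (fun s => rho * (u s)^-1).
  apply: continuous_mul; first exact: continuous_cst.
  exact: (continuous_inv u0 uc).
case: (i == ord_max).
  apply: continuous_mul; last exact: continuous_cst.
  exact: (continuous_sub wc wc').
apply: continuous_add; first exact: continuous_cst.
apply: continuous_mul; last exact: continuous_cst.
exact: (continuous_add wc wc').
Qed.

Let continuous_W (u : R -> C R) : continuous u -> (forall s, u s != 0) ->
  continuous (fun s => W (u s)) /\ continuous (fun s => W' (u s)).
Proof.
move=> uc u0.
have fpc := continuous_compose (continuous_pt uc u0) fc.
have ec i : continuous (fun s => f (pt (u s)) i 0).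
  exact: continuous_compose fpc (@continuous_entry _ _ _ _ _).
have c1 : continuous (fun s => nu * (f (pt (u s)) ord0 0 - kap / m.+1%:R)).
  apply: continuous_mul; first exact: continuous_cst.
  by apply: continuous_sub; [exact: ec|exact: continuous_cst].
have c2 : continuous (fun s => im * f (pt (u s)) ord_max 0).
  by apply: continuous_mul; [exact: continuous_cst|exact: ec].
by split; [exact: continuous_add c1 c2|exact: continuous_sub c1 c2].
Qed.

Let zetaX0 j : zeta ^+ j != 0. Proof. exact: expf_neq0. Qed.

(* The sign records in which direction [f] turns along the circle. *)
Let same_direction j :
  (0 < y * complex.Im (W (zeta ^+ j.+1) * W' (zeta ^+ j))) =
  (0 < y * complex.Im (W (zeta ^+ j.+2) * W' (zeta ^+ j.+1))).
Proof.
(* The straight path from [zeta ^+ j] to [zeta ^+ j.+1]; it avoids 0 because [zeta] is not real. *)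
pose u (s : R) : C R := zeta ^+ j * (1 + s%:K * (zeta - 1)).
have uc : continuous u.
  apply: continuous_mul; first exact: continuous_cst.
  apply: continuous_add; first exact: continuous_cst.
  apply: continuous_mul; last exact: continuous_cst.
  exact: continuous_real_complex.
have u0 s : u s != 0.
  rewrite mulf_neq0 //; apply/negP; rewrite eq_complex /= => /andP[/eqP h1 /eqP h2].
  have : s * y = 0 by move: h2 => <-; ring.
  move/eqP; rewrite mulf_eq0 (negPf y0) orbF => /eqP s0.
  by move/eqP: h1; rewrite s0 !mul0r subr0 addr0 oner_eq0.
have zuc : continuous (fun s => zeta * u s).
  by apply: continuous_mul uc; exact: continuous_cst.
have zu0 s : zeta * u s != 0 by rewrite mulf_neq0.
pose h s := y * complex.Im (W (zeta * u s) * W' (u s)).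
have hc : continuous h.
  apply: continuous_mul; first exact: continuous_cst.
  apply: (continuous_compose _ (@continuous_Im R)).
  have [c1 _] := continuous_W zuc zu0; have [_ c2] := continuous_W uc u0.
  exact: (continuous_mul c1 c2).
have uE0 : u 0 = zeta ^+ j by rewrite /u mul0r addr0 mulr1.
have uE1 : u 1 = zeta ^+ j.+1 by rewrite /u mul1r addrC subrK exprSr.
have := nonvanishing_sign hc; rewrite /h uE0 uE1 -!exprS; apply=> s _.
(* The two alternatives give the values rho2 y^2 and - rho2 y^2, neither of which is zero. *)
case: (step (u0 s)) => ->; rewrite /= mul0r addr0 ?mulrN ?oppr_eq0.
  by rewrite !mulf_neq0 // gt_eqF.
by rewrite !mulf_neq0 // gt_eqF.
Qed.

(** With a constant direction [z], [W (zeta ^+ j)] is [z ^+ j * W 1]. The resulting distance is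
    symmetric in [zeta] and [zeta'], so the direction does not affect it. *)
Lemma phi_f_circle k : phi (f (pt (zeta ^+ k))) (f (pt 1)) =
  rho2%:K * ((zeta ^+ k - 1) * (zeta' ^+ k - 1)).
Proof.
have z1 : zeta ^+ 0 = 1 by [].
pose up j := 0 < y * complex.Im (W (zeta ^+ j.+1) * W' (zeta ^+ j)).
have dir : forall j, up j = up 0%N by exact: constant_of_succ same_direction.
have [z [zE zz]] : exists z, (forall j, W (zeta ^+ j.+1) * W' (zeta ^+ j) = rho2%:K * z)
    /\ (z = zeta \/ z = zeta').
  exists (if up 0%N then zeta else zeta').
  split; last by case: ifP; [left|right].
  move=> j; rewrite -(dir j) /up exprS.
  case: (step (zetaX0 j)) => ->; rewrite /= mul0r addr0 ?mulrN ?oppr_gt0 mulrCA.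
    by rewrite pmulr_rgt0 // -expr2 exprn_even_gt0 ?y0.
  by rewrite pmulr_rlt0 // -expr2 ltNge sqr_ge0.
(* The second factor is the other one of [zeta] and [zeta'], written uniformly for both cases. *)
have zz1 : z * (zeta + zeta' - z) = 1.
  by case: zz => ->; rewrite ?(addrAC _ _ (- zeta)) ?subrr ?add0r ?addrK // mulrC.
set z' := _ - z in zz1.
have Wk j : W (zeta ^+ j) = z ^+ j * W 1.
  elim: j => [|j IH]; first by rewrite z1 mul1r.
  have W'0 : W' (zeta ^+ j) != 0.
    apply: contra_neq rho2_neq0 => W'0.
    by rewrite -(WW' (zetaX0 j)) W'0 mulr0.
  apply: (mulIf W'0); rewrite zE exprS -mulrA -IH.
  by rewrite -mulrA WW' // mulrC.
have W'k j : W' (zeta ^+ j) = z' ^+ j * W' 1.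
  have W0 : W (zeta ^+ j) != 0.
    apply: contra_neq rho2_neq0 => W0.
    by rewrite -(WW' (zetaX0 j)) W0 mul0r.
  apply: (mulfI W0); rewrite WW' // Wk mulrACA -exprMn zz1 expr1n mul1r.
  by rewrite WW' // oner_neq0.
rewrite phi_f_pt ?oner_neq0 // Wk W'k.
rewrite -{2}[W 1]mul1r -{2}[W' 1]mul1r -!mulrBl mulrACA WW' ?oner_neq0 // mulrC.
congr (_ * _); rewrite /z'; case: zz => ->; first by rewrite addrAC subrr add0r.
by rewrite addrK; exact: mulrC.
Qed.

End Image.

Lemma circle_preserved (r : R) k : r != 0 ->
  r%:K = rho2%:K * ((zeta ^+ k - 1) * (zeta' ^+ k - 1)) ->
  always_preserved m.+2 r.
Proof.
move=> r0 rE; apply: (@always_preserved_pair _ _ _ (pt (zeta ^+ k)) (pt 1)) => //.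
  by rewrite phi_pt invr1 -exprVn zetaV rE.
move=> f fc fu; have [g [gc gu gphi gv]] := fix_unit_simplex (ltn0Sn _) fc fu.
by rewrite -gphi (phi_f_circle gc gu gv).
Qed.

End Circle.

(** * All positive distances *)

(** For e = 2 - 2 cos theta this is (sin (k theta / 2) / sin (theta / 2))^2, the squared chord of
    [k] steps over that of one step. As a polynomial in [e] it also makes sense at [e = 0]. *)
Fixpoint chord (R : pzRingType) (e : R) (k : nat) : R :=
  if k is k1.+1 then
    if k1 is k2.+1 then (2 - e) * chord e k1 - chord e k2 + 2 else 1
  else 0.

Lemma chordSS (R : pzRingType) (e : R) k :
  chord e k.+2 = (2 - e) * chord e k.+1 - chord e k + 2.
Proof. by []. Qed.

Lemma nat_ind2 (P : nat -> Prop) :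
  P 0%N -> P 1%N -> (forall k, P k -> P k.+1 -> P k.+2) -> forall k, P k.
Proof.
move=> P0 P1 PS k; suff : P k /\ P k.+1 by case.
by elim: k => // k [Pk Pk1]; split=> //; apply: PS.
Qed.

Lemma chord0 (R : comPzRingType) k : chord (0 : R) k = k%:R ^+ 2.
Proof.
elim/nat_ind2: k => [||k IH IH1]; rewrite ?expr0n ?expr1n //.
by rewrite chordSS IH IH1 -!natr1; ring.
Qed.

(** Being a perfect square, it yields preserved squared distances of the form b^2. *)
Lemma chord5 (R : comPzRingType) (e : R) : chord e 5 = (5 - 5 * e + e ^+ 2) ^+ 2.
Proof. by rewrite /=; ring. Qed.

Lemma continuous_chord (R : realType) k : continuous (fun e : R => chord e k).
Proof.
elim/nat_ind2: k => [||k IH IH1]; try exact: continuous_cst.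
apply: continuous_add; last exact: continuous_cst.
apply: continuous_sub IH; apply: continuous_mul IH1.
by apply: continuous_sub; [exact: continuous_cst | move=> e].
Qed.

(** The left side is 2 minus the power sum z^k + z'^k, and power sums satisfy a two-term
    recurrence. *)
Lemma chord_rotation (R : comPzRingType) (z z' : R) k : z * z' = 1 ->
  (z ^+ k - 1) * (z' ^+ k - 1) = (2 - (z + z')) * chord (2 - (z + z')) k.
Proof.
move=> zz.
have E j : (z ^+ j - 1) * (z' ^+ j - 1) = 2 - (z ^+ j + z' ^+ j).
  by rewrite mulrBl !mulrBr -exprMn zz expr1n; ring.
rewrite E; elim/nat_ind2: k => [||k IH IH1]; rewrite ?chordSS /=.
- by rewrite !expr0; ring.
- by rewrite !expr1; ring.
have zS : (z + z') * (z ^+ k.+1 + z' ^+ k.+1) = z ^+ k.+2 + z' ^+ k.+2 + (z ^+ k + z' ^+ k).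
  have -> : (z + z') * (z ^+ k.+1 + z' ^+ k.+1) =
    z ^+ k.+2 + z' ^+ k.+2 + (z * z') * (z ^+ k + z' ^+ k) by rewrite !exprS; ring.
  by rewrite zz mul1r.
set e := 2 - (z + z') in IH IH1 *.
have -> : e * ((2 - e) * chord e k.+1 - chord e k + 2) =
  (2 - e) * (e * chord e k.+1) - e * chord e k + 2 * e by ring.
rewrite -IH -IH1 /e.
have -> : 2 - (2 - (z + z')) = z + z' by ring.
by rewrite mulrBr zS; ring.
Qed.

Section Circles.
Variables (R : realType) (m : nat).
Local Notation P := (@always_preserved R m.+2).
Local Notation N := (m.+1%:R : R).

Lemma chord_preserved (d t e rho2 : R) k : P d -> P t ->
  rho2 = d - 2^-1 + (2 * N)^-1 -> 0 < rho2 -> t = rho2 * e -> 0 < e < 4 ->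
  chord e k != 0 -> P (t * chord e k).
Proof.
move=> Pd Pt rhoE rho0 tE /andP[e0 e4] c0.
(* Cosine and sine of the angle of one step; 0 < e < 4 makes the sine nonzero. *)
pose x := 1 - e / 2; pose y := Num.sqrt (1 - x ^+ 2).
have y20 : 0 < 1 - x ^+ 2.
  have -> : 1 - x ^+ 2 = e * (4 - e) / 4 by rewrite /x; field.
  by rewrite divr_gt0 // mulr_gt0 // subr_gt0.
have xy : x ^+ 2 + y ^+ 2 = 1 by rewrite sqr_sqrtr ?ltW // addrC subrK.
have y0 : y != 0 by rewrite gt_eqF // sqrtr_gt0.
have eE : e = 2 - 2 * x by rewrite /x; field.
have t0 : t != 0 by rewrite tE mulf_neq0 // gt_eqF.
have tE' : t = rho2 * (2 - 2 * x) by rewrite tE eE.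
apply: (@circle_preserved _ _ _ _ _ _ _ Pd Pt rhoE rho0 xy y0 tE' _ k).
  exact: mulf_neq0.
have zz : ((x +i* y)%C : C R) * (x -i* y)%C = 1.
  apply/eqP; rewrite eq_complex /= mulrN opprK -!expr2 xy eqxx /=.
  by apply/eqP; ring.
have zD : ((x +i* y)%C : C R) + (x -i* y)%C = (2 - e)%:K.
  apply/eqP; rewrite eq_complex /= subrr eqxx andbT.
  by apply/eqP; rewrite /x; field.
have chordK (u : R) j : chord u%:K j = (chord u j)%:K.
  elim/nat_ind2: j => // j IH IH1.
  rewrite !chordSS IH IH1 rmorphD rmorphB rmorphM rmorphB.
  by rewrite (rmorph_nat (real_complex R) 2).
rewrite (chord_rotation _ zz) zD.
have -> : 2 - (2 - e)%:K = e%:K.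
  by rewrite rmorphB (rmorph_nat (real_complex R) 2) /= subKr.
by rewrite chordK tE !rmorphM mulrA.
Qed.
Let N_ge1 : 1 <= N. Proof. by rewrite ler1n. Qed.
Let P1 : P 1. Proof. exact: always_preserved1. Qed.

(** The case d = t = 1: the squared radius is (N + 1) / (2 N), and [e] is its inverse. *)
Lemma unit_chord_preserved k : chord (2 * N / (N + 1)) k != 0 ->
  P (chord (2 * N / (N + 1)) k).
Proof.
have N1 : 0 < N + 1 by rewrite addr_gt0.
move=> c0; rewrite -[chord _ _]mul1r.
apply: (@chord_preserved 1 1 _ ((N + 1) / (2 * N)) _ P1 P1 _ _ _ _ c0).
- by field; rewrite gt_eqF.
- by rewrite divr_gt0 // mulr_gt0.
- by field; rewrite !gt_eqF.
by rewrite divr_gt0 ?mulr_gt0 //= ltr_pdivrMr //; move: N_ge1; lra.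
Qed.

(** Two unit steps give 4 - e with e < 2. The powers of this value provide arbitrarily large
    preserved distances. *)
Lemma exists_preserved_gt2 : exists2 s, 2 < s & P s.
Proof.
have N1 : 0 < N + 1 by rewrite addr_gt0.
have c2 : 2 < chord (2 * N / (N + 1)) 2.
  have : 2 * N / (N + 1) < 2 by rewrite ltr_pdivrMr // mulrDr mulr1 ltrDl.
  by rewrite /=; move: (2 * N / (N + 1)) => e; lra.
exists (chord (2 * N / (N + 1)) 2) => //.
by apply: unit_chord_preserved; rewrite gt_eqF // (lt_trans _ c2).
Qed.

(* Unit chords of a circle of radius tending to infinity: [k] of them in a row
   reach distance [k] in the limit. *)
Lemma square_preserved k : (0 < k)%N -> P (k%:R ^+ 2).
Proof.
move=> k0; have k20 : 0 < k%:R ^+ 2 :> R by rewrite exprn_gt0 // ltr0n.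
apply: always_preserved_closed => // eps eps0.
(* The second bound keeps the approximating chord positive. *)
pose eps' := Num.min eps (k%:R ^+ 2).
have eps'0 : 0 < eps' by rewrite lt_min eps0.
have /cvgrPdist_lt/(_ _ eps'0)/nbhs_ballP[del /= del0 hdel] :=
  @continuous_chord R k 0.
have [s s2 Ps] := exists_preserved_gt2.
(* Since s > 2, s^j exceeds 1 / del + 1, so the inverse squared radius [e] falls below [del]. *)
pose j := (Num.truncn (del^-1 + 1)).+1.
pose rho2 := s ^+ j - 2^-1 + (2 * N)^-1.
have s0 : 0 < s by rewrite (lt_trans _ s2).
have hj : del^-1 + 1 < s ^+ j.
  apply: (@lt_le_trans _ _ j%:R); first exact: truncnS_gt.
  apply: (@le_trans _ _ (2 ^+ j)); last by rewrite lerXn2r ?nnegrE // ltW.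
  by rewrite -natrX ler_nat ltnW // ltn_expl.
have hN : 0 < (2 * N)^-1 by rewrite invr_gt0 mulr_gt0.
have hdel1 : 0 < del^-1 by rewrite invr_gt0.
have [hrho hrho2] : del^-1 < rho2 /\ 2^-1 < rho2.
  rewrite /rho2; move: (s ^+ j) ((2 * N)^-1) (del^-1) hj hN hdel1 => u v w.
  by split; lra.
have rho0 : 0 < rho2 by rewrite (lt_trans _ hrho).
pose e := rho2^-1.
have e0 : 0 < e by rewrite invr_gt0.
have := hdel e; rewrite /ball /= sub0r normrN (gtr0_norm e0).
rewrite chord0 -{1}[del]invrK /e ltf_pV2 ?posrE // => /(_ hrho).
rewrite lt_min distrC => /andP[he1 he2].
have c0 : 0 < chord e k.
  by move: he2; rewrite ltr_norml => /andP[]; rewrite ltrBrDl subrr.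
exists (chord e k); split=> //.
rewrite -[chord _ _]mul1r.
apply: (@chord_preserved (s ^+ j) 1 e rho2) => //.
- exact: always_preserved_exp.
- by rewrite /e mulfV // gt_eqF.
- rewrite e0 /= -[4]invrK /e ltf_pV2 ?posrE ?invr_gt0 //.
  by apply: lt_trans hrho2; rewrite ltf_pV2 ?posrE //; lra.
- by rewrite gt_eqF.
Qed.

Lemma exists_small_preserved : exists2 b, 0 < b < 1 & P (b ^+ 2).
Proof.
have pN1 : 0 < N + 1 by rewrite addr_gt0.
have [m0|m0] := posnP m.
  (* In the plane five unit steps on the unit circle only return the distance 1. Instead, steps of
     squared length 4 are taken on the circle of squared radius 3. *)
  exists (2 / 9); first by apply/andP; split; lra.
  have P3 : P 3.
    have e1 : 2 * N / (N + 1) = 1 by rewrite m0 mulr1 divff // pnatr_eq0.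
    have c2 : chord (1 : R) 2 = 3 by rewrite /=; ring.
    by have := @unit_chord_preserved 2; rewrite e1 c2 pnatr_eq0; apply.
  have P4 : P 4 by have := @square_preserved 2 isT; rewrite (_ : 2%:R ^+ 2 = 4) //; ring.
  have c5 : chord (4 / 3 : R) 5 = 9^-1 ^+ 2 by rewrite chord5; field.
  have -> : (2 / 9) ^+ 2 = 4 * chord (4 / 3 : R) 5 by rewrite c5; field.
  apply: (@chord_preserved 3 4 _ 3) => //.
  - by rewrite m0; field.
  - by field.
  - by apply/andP; split; lra.
  - by rewrite c5 expf_neq0 // invr_neq0 // pnatr_eq0.
(* Here e = 2 - a, and the root of the five-step chord is a^2 + a - 1. It lies in (-1, 1) as 0 < a <
   1, and it is nonzero because 5 is not a square. *)
pose a := 2 / (N + 1).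
have aE : 5 - 5 * (2 * N / (N + 1)) + (2 * N / (N + 1)) ^+ 2 = a ^+ 2 + a - 1.
  by rewrite /a; field; rewrite gt_eqF.
have N2 : 2 <= N by rewrite ler_nat ltnS.
have a0 : 0 < a by rewrite divr_gt0.
have a1 : a < 1 by rewrite /a ltr_pdivrMr //; move: N2; lra.
have q0 : a ^+ 2 + a - 1 != 0.
  have -> : a ^+ 2 + a - 1 = (5 - N ^+ 2) / (N + 1) ^+ 2.
    by rewrite /a; field; rewrite gt_eqF.
  apply: mulf_neq0; last by rewrite invr_neq0 // expf_neq0 // gt_eqF.
  rewrite subr_eq0 -natrX eqr_nat; apply/negP => /eqP.
  case: m m0 => [|[|[|k]]] // _ H.
  have : (9 < k.+4 ^ 2)%N by rewrite (@leq_trans (4 ^ 2)) // leq_sqr.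
  by rewrite -H.
exists `|a ^+ 2 + a - 1|.
  rewrite normr_gt0 q0 ltr_norml /= -subr_gt0; apply/andP; split.
    by rewrite opprK subrK addr_gt0 // exprn_gt0.
  have : a ^+ 2 < 1 by rewrite expr_lt1 // ltW.
  by move: a1; lra.
rewrite real_normK ?num_real // -aE -chord5.
by apply: unit_chord_preserved; rewrite chord5 aE expf_neq0.
Qed.

Lemma positive_preserved (r : R) : 0 < r -> P r.
Proof.
move=> r0; have [b /andP[b0 b1] Pb] := exists_small_preserved.
apply: always_preserved_closed => // eps eps0.
pose l := Num.sqrt r; have l0 : 0 < l by rewrite sqrtr_gt0.
have l2 : l ^+ 2 = r by rewrite sqr_sqrtr // ltW.
(* The root [l] is approximated by a multiple k h of h = b^M < del. The bound h < l makes k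
   positive, and the error on squares is at most 2 l h < eps. *)
pose del := Num.min l (eps / (2 * l)).
have del0 : 0 < del by rewrite lt_min l0 divr_gt0 // mulr_gt0.
have [M hM] : exists M, b ^+ M < del.
  have /cvgrPdist_lt/(_ _ del0) : (b ^+ k @[k --> \oo] --> (0 : R))%classic.
    by apply: cvg_expr; rewrite gtr0_norm.
  case=> M _ /(_ M (leqnn M)) /=; rewrite sub0r normrN gtr0_norm ?exprn_gt0 //.
  by exists M.
set h := b ^+ M in hM; have h0 : 0 < h by rewrite exprn_gt0.
move: hM; rewrite lt_min => /andP[hl heps].
pose k := Num.truncn (l / h).
have /andP[kl lk] : k%:R <= l / h < k.+1%:R by apply: truncn_itv; rewrite ltW ?divr_gt0.
have k0 : (0 < k)%N by rewrite truncn_gt0 ler_pdivlMr // mul1r ltW.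
have khl : k%:R * h <= l by rewrite -ler_pdivlMr.
have lkh : l < k%:R * h + h by move: lk; rewrite ltr_pdivrMr // -natr1 mulrDl mul1r.
have kh0 : 0 < k%:R * h by rewrite mulr_gt0 // ltr0n.
exists (k%:R ^+ 2 * (b ^+ 2) ^+ M); split.
- by rewrite mulr_gt0 ?exprn_gt0 ?ltr0n // exprn_gt0.
- rewrite exprAC -/h -exprMn -l2 subr_sqr normrM distrC.
  have -> : `|l - k%:R * h| = l - k%:R * h by rewrite ger0_norm // subr_ge0.
  have -> : `|k%:R * h + l| = k%:R * h + l by rewrite gtr0_norm // addr_gt0.
  apply: (@le_lt_trans _ _ (h * (2 * l))).
    apply: ler_pM; first by rewrite subr_ge0.
    - by rewrite addr_ge0 // ltW.
    - by rewrite lerBlDl ltW.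
    - by rewrite mulr2n mulrDl mul1r lerD2r.
  by rewrite -ltr_pdivlMr // mulr_gt0.
apply: always_preserved_mul; first by rewrite exprn_gt0 // ltr0n.
  exact: square_preserved.
by apply: always_preserved_exp => //; rewrite exprn_gt0.
Qed.

End Circles.

(** * Fixing the real points *)

Section RealVectors.
Variables (R : realType) (n : nat).
Implicit Types (a b : 'cV[R]_n) (Y : 'cV[C R]_n).

Definition real_vec a : 'cV[C R]_n := map_mx (real_complex R) a.
Definition re_vec Y : 'cV[R]_n := map_mx (fun z : C R => complex.Re z) Y.
Definition im_vec Y : 'cV[R]_n := map_mx (fun z : C R => complex.Im z) Y.

Lemma vec_re_im Y : Y = real_vec (re_vec Y) + 'i *: real_vec (im_vec Y).
Proof.
apply/matrixP => i j; rewrite !mxE [LHS]complexE.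
by [].
Qed.

Lemma dot_real a b : dot (real_vec a) (real_vec b) = (dot a b)%:K.
Proof.
rewrite !dotE (rmorph_sum (real_complex R)); apply: eq_bigr => i _.
by rewrite !mxE rmorphM.
Qed.

Lemma dot_delta (K : numFieldType) (u : 'cV[K]_n) j : dot u (delta_mx j 0) = u j 0.
Proof.
rewrite dotE (bigD1 j) //= big1 ?addr0 ?mxE ?eqxx ?mulr1 // => k kj.
by rewrite mxE (negPf kj) mulr0.
Qed.

Lemma dot_ge0 a : 0 <= dot a a.
Proof. by rewrite dotE sumr_ge0 // => i _; rewrite -expr2 sqr_ge0. Qed.

Lemma dot_eq0 a : (dot a a == 0) = (a == 0).
Proof.
apply/idP/eqP => [|->]; last by rewrite dotE big1 // => i _; rewrite mxE mul0r.
rewrite dotE psumr_eq0 => [/allP a0|i _]; last by rewrite -expr2 sqr_ge0.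
apply/matrixP => i j; rewrite (ord1 j) mxE; apply/eqP.
by have := a0 i (mem_index_enum i); rewrite -expr2 sqrf_eq0.
Qed.

Lemma dot_gt0 a : (0 < dot a a) = (a != 0).
Proof. by rewrite lt_def dot_eq0 dot_ge0 andbT. Qed.

End RealVectors.

Section RealFrame.
Variables (R : realType) (m : nat).
Local Notation V := ('cV[C R]_m.+2).
Variable f : V -> V.
Hypotheses (fc : continuous f) (fu : preserves_unit_distance f).

(** Distinct real points have positive squared distance, since [dot] is definite on real vectors. *)
Lemma phi_real (a b : 'cV[R]_m.+2) :
  phi (f (real_vec a)) (f (real_vec b)) = phi (real_vec a) (real_vec b).
Proof.
have E : phi (real_vec a) (real_vec b) = (dot (a - b) (a - b))%:K.
  by rewrite phiE -dot_real /real_vec map_mxB.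
have [ab|ab] := eqVneq (a - b) 0.
  move/eqP: ab; rewrite subr_eq0 => /eqP ->.
  by rewrite !phiE !subrr.
rewrite E; apply: (positive_preserved (r := dot (a - b) (a - b))) => //.
by rewrite dot_gt0.
Qed.

(** The images of the origin and of the standard basis form an orthonormal frame; undoing it gives
    [g]. By polarization, distances to these fixed points determine each coordinate of the image of
    a real point. *)
Lemma real_frame : exists (L : 'M[C R]_m.+2) b (g : V -> V),
  [/\ L^T *m L = 1%:M, forall X, f X = L *m g X + b,
      continuous g, preserves_unit_distance g &
      forall a, g (real_vec a) = real_vec a].
Proof.
pose E (j : 'I_m.+2) : 'cV[R]_m.+2 := delta_mx j 0.
have EK j : real_vec (E j) = delta_mx j 0 by rewrite /real_vec map_delta_mx.
have E0 : real_vec (0 : 'cV[R]_m.+2) = 0 by rewrite /real_vec map_mx0.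
pose M := edge_matrix (fun j => f (real_vec (E j))) (f (real_vec 0)).
have two0 : (2 : C R) != 0 by rewrite pnatr_eq0.
have MM : M^T *m M = 1%:M.
  apply/matrixP => i j; rewrite edge_matrix_gram; apply: (mulfI two0).
  rewrite phi_polar !phi_real -phi_polar E0 !subr0 !EK dot_delta !mxE eqxx.
  by rewrite andbT eq_sym.
have MM' : M *m M^T = 1%:M by apply: mulmx1C.
pose g X := M^T *m f X + - (M^T *m f (real_vec 0)).
have gphi X Y : phi (g X) (g Y) = phi (f X) (f Y).
  by apply: phi_affine; rewrite trmxK.
have g0 : g (real_vec 0) = 0 by rewrite /g subrr.
have gE j : g (real_vec (E j)) = real_vec (E j).
  rewrite /g -mulmxBr.
  have -> : f (real_vec (E j)) - f (real_vec 0) = col j M.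
    by apply/matrixP => k l; rewrite (ord1 l) !mxE.
  by rewrite colE mulmxA MM mul1mx EK.
exists M, (f (real_vec 0)), g; split.
- exact: MM.
- by move=> X; rewrite /g -mulmxBr mulmxA MM' mul1mx subrK.
- exact: continuous_compose fc (@continuous_affine _ _ _ _ _ _).
- by move=> X Y XY; rewrite gphi; exact: fu.
move=> a; apply/matrixP => j l; rewrite (ord1 l) -!dot_delta -EK.
apply: (mulfI two0).
have := phi_polar (g (real_vec a)) (g (real_vec (E j))) (g (real_vec 0)).
rewrite !gphi !phi_real -phi_polar g0 gE E0 !subr0.
exact: id.
Qed.

End RealFrame.

(** * Maps fixing the real points: identity or conjugation *)

Section Conjugation.
Variables (R : realType) (m : nat).
Local Notation V := ('cV[C R]_m.+2).
Variable g : V -> V.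
Hypotheses (gc : continuous g) (gu : preserves_unit_distance g).
Hypothesis g_real : forall a, g (real_vec a) = real_vec a.

Definition conj_vec (Y : V) : V := coordinatewise (@tau R) Y.

Lemma conj_vecE Y : conj_vec Y = real_vec (re_vec Y) - 'i *: real_vec (im_vec Y).
Proof.
apply/matrixP => i j; rewrite !mxE /tau.
case: (Y i j) => a b; apply/eqP; rewrite eq_complex /=.
by apply/andP; split; apply/eqP; ring.
Qed.

(* The points of [re_vec Y + im_vec Y]^perp at unit distance from [Y] are real,
   hence fixed, and they come in pairs symmetric about [re_vec Y]. *)
Lemma dot_image_orthogonal Y (c : 'cV[R]_m.+2) :
  c != 0 -> dot (im_vec Y) c = 0 ->
  dot (g Y - real_vec (re_vec Y)) (real_vec c) = 0 /\
  dot (g Y - real_vec (re_vec Y)) (g Y - real_vec (re_vec Y)) =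
    - (dot (im_vec Y) (im_vec Y))%:K.
Proof.
set a := re_vec Y; set b := im_vec Y => c0 bc; set z := g Y - real_vec a.
have q0 : 0 < dot c c by rewrite dot_gt0.
(* Chosen so that a + s c and a - s c are at unit distance from [Y]: the imaginary part contributes
   - |b|^2. *)
pose s := Num.sqrt ((dot b b + 1) / dot c c).
have s0 : 0 < s by rewrite sqrtr_gt0 divr_gt0 // ltr_pwDr // dot_ge0.
have s2 : s * s * dot c c = dot b b + 1.
  rewrite -expr2 sqr_sqrtr ?divfK ?gt_eqF // divr_ge0 ?dot_ge0 //.
  by rewrite addr_ge0 ?dot_ge0.
pose Cc := real_vec c.
have bcK : dot (real_vec b) Cc = 0 by rewrite dot_real bc.
have ccK : s%:K * s%:K * dot Cc Cc = dot (real_vec b) (real_vec b) + 1.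
  by rewrite !dot_real -!rmorphM s2 rmorphD.
have unit_z (e : R) : e * e = 1 ->
    dot z z - 2 * e%:K * s%:K * dot z Cc = - dot (real_vec b) (real_vec b).
  move=> e1; have ee : e%:K * e%:K = 1 by rewrite -rmorphM e1.
  have cE : real_vec (a + (e * s) *: c) = real_vec a + (e%:K * s%:K) *: Cc.
    by apply/matrixP => i j; rewrite !mxE rmorphD !rmorphM.
  have : phi Y (real_vec (a + (e * s) *: c)) = 1 ^+ 2.
    rewrite phiE cE {1 2}[Y]vec_re_im -/a -/b opprD addrACA subrr add0r.
    rewrite !(dotDl, dotDr, dotNl, dotNr, dotZl, dotZr) (dotC Cc) bcK.
    have -> : e%:K * s%:K * (e%:K * s%:K * dot Cc Cc) =
      (e%:K * e%:K) * (s%:K * s%:K * dot Cc Cc) by ring.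
    rewrite ee ccK !mulr0 !mulrA -expr2 sqrCi expr1n.
    by ring.
  move/gu; rewrite g_real cE phiE expr1n opprD addrA -/z.
  clearbody z.
  rewrite !(dotDl, dotDr, dotNl, dotNr, dotZl, dotZr) (dotC Cc).
  have -> : e%:K * s%:K * (e%:K * s%:K * dot Cc Cc) =
      (e%:K * e%:K) * (s%:K * s%:K * dot Cc Cc) by ring.
  rewrite ee ccK => h; apply: (addIr (dot (real_vec b) (real_vec b) + 1)).
  by rewrite addKr -[RHS]h; ring.
have h1 := unit_z 1 (mulr1 1).
have h2 := unit_z (-1) (etrans (mulrNN 1 1) (mulr1 1)).
have two0 : (2 : C R) != 0 by rewrite pnatr_eq0.
have sK0 : s%:K != 0.
  by rewrite (_ : 0 = 0%:K) // (inj_eq (@complexI _)) gt_eqF.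
(* The equations for the two signs differ only in the term with [dot z Cc], so their difference
   isolates it. *)
have zc : dot z Cc = 0.
  apply: (mulfI (mulf_neq0 two0 (mulf_neq0 two0 sK0))); rewrite mulr0.
  move: h1 h2; rewrite rmorphN rmorph1 => h1 h2.
  transitivity (dot z z - 2 * -1 * s%:K * dot z Cc - (dot z z - 2 * 1 * s%:K * dot z Cc)).
    by ring.
  by rewrite h1 h2 subrr.
by split=> //; move: h1; rewrite zc mulr0 subr0 dot_real.
Qed.

(** The vector z = g Y - a is orthogonal to every real vector orthogonal to b, hence z = lam b; the
    value of [dot z z] then gives lam^2 = -1. *)
Lemma image_eq_or_conj Y : g Y = Y \/ g Y = conj_vec Y.
Proof.
set a := re_vec Y; set b := im_vec Y.
have [b0|b0] := eqVneq b 0.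
  left; have {1 2}-> : Y = real_vec a.
    by rewrite [LHS]vec_re_im -/b b0 /real_vec map_mx0 scaler0 addr0.
  exact: g_real.
have [j bj] : exists j, b j 0 != 0.
  apply/existsP; apply: contraNT b0 => /existsPn b0.
  apply/eqP/matrixP => i l; rewrite (ord1 l) [RHS]mxE; apply/eqP.
  by have := b0 i; rewrite negbK.
set z := g Y - real_vec a.
have zi i : i != j ->
    z i 0 * (b j 0)%:K = z j 0 * (b i 0)%:K /\ dot z z = - (dot b b)%:K.
  move=> ij; pose c : 'cV[R]_m.+2 := b j 0 *: delta_mx i 0 - b i 0 *: delta_mx j 0.
  have c0 : c != 0.
    apply: contraNneq bj => /matrixP/(_ i 0); rewrite !mxE !eqxx (negPf ij) /=.
    by rewrite mulr0 subr0 mulr1 => ->.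
  have bc : dot b c = 0.
    by rewrite dotDr dotNr !dotZr !dot_delta mulrC subrr.
  have [zc zz] := dot_image_orthogonal c0 bc; split; last exact: zz.
  have cK : real_vec c = (b j 0)%:K *: delta_mx i 0 - (b i 0)%:K *: delta_mx j 0.
    apply/matrixP => k l; rewrite !mxE rmorphB !rmorphM.
    by rewrite !(rmorph_nat (real_complex R)).
  move: zc; rewrite cK dotDr dotNr !dotZr !dot_delta => /eqP; rewrite subr_eq0 => /eqP.
  by rewrite mulrC => ->; rewrite mulrC.
have bjK : (b j 0)%:K != 0.
  by rewrite (_ : 0 = 0%:K) // (inj_eq (@complexI _)).
pose lam := z j 0 / (b j 0)%:K.
have zE : z = lam *: real_vec b.
  apply/matrixP => i l; rewrite (ord1 l) [RHS]mxE [X in _ * X]mxE /lam.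
  have [->|/zi[h _]] := eqVneq i j; first by rewrite divfK.
  by apply: (mulIf bjK); rewrite h mulrAC divfK.
(* Dimension at least 2 provides a nonzero real vector orthogonal to b, without which [dot z z]
   would be unknown. *)
have [i ij] : exists i, i != j.
  case: (eqVneq ord0 j) => [<-|]; last by exists ord0.
  by exists ord_max.
have [_] := zi i ij; rewrite zE dotZl dotZr dot_real mulrA => /eqP.
have bbK : (dot b b)%:K != 0.
  by rewrite (_ : 0 = 0%:K) // (inj_eq (@complexI _)) dot_eq0.
rewrite -mulN1r (inj_eq (mulIf bbK)) -sqrCi -expr2 eqf_sqr => lamE.
have gE : g Y = real_vec a + z by rewrite addrC subrK.
case/orP: lamE => /eqP lamE; [left|right]; rewrite gE zE lamE.
  by rewrite [RHS]vec_re_im.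
by rewrite conj_vecE scaleNr.
Qed.

(** A continuous quantity whose sign, at a non-real point, tells the identity from the
    conjugation. *)
Definition im_correlation Y : R := dot (im_vec (g Y)) (im_vec Y).

Lemma im_correlation_id Y :
  im_vec Y != 0 -> g Y = Y -> 0 < im_correlation Y.
Proof. by move=> Y0 gY; rewrite /im_correlation gY dot_gt0. Qed.

Lemma im_vec_conj Y : im_vec (conj_vec Y) = - im_vec Y.
Proof. by apply/matrixP => i j; rewrite !mxE /tau; case: (Y i j). Qed.

Lemma im_correlation_conj Y :
  im_vec Y != 0 -> g Y = conj_vec Y -> im_correlation Y < 0.
Proof.
by move=> Y0 gY; rewrite /im_correlation gY im_vec_conj dotNl oppr_lt0 dot_gt0.
Qed.

Lemma im_correlation_segment Y Y' :
  (forall s : R, 0 <= s <= 1 -> (1 - s) *: im_vec Y + s *: im_vec Y' != 0) ->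
  (0 < im_correlation Y) = (0 < im_correlation Y').
Proof.
move=> YY'; pose u (s : R) : V := Y + s%:K *: (Y' - Y).
have uc : continuous u.
  apply: continuous_mx => i j; under eq_fun do rewrite !mxE.
  apply: continuous_add; first exact: continuous_cst.
  by apply: continuous_mul; [exact: continuous_real_complex|exact: continuous_cst].
have u0 : u 0 = Y by rewrite /u scale0r addr0.
have u1 : u 1 = Y' by rewrite /u scale1r addrC subrK.
rewrite -{1}u0 -u1; apply: (@nonvanishing_sign _ (fun s => im_correlation (u s))).
  rewrite /im_correlation; under eq_fun do rewrite dotE.
  apply: continuous_sum => i.
  have entry_c (h : R -> V) : continuous h ->
      continuous (fun s => im_vec (h s) i 0).
    move=> hc; under eq_fun do rewrite mxE.
    apply: continuous_compose (@continuous_Im R).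
    exact: continuous_compose hc (@continuous_entry _ _ _ _ _).
  have guc := continuous_compose uc gc.
  exact: (continuous_mul (entry_c _ guc) (entry_c _ uc)).
move=> s /YY' us0.
have im_u : im_vec (u s) = (1 - s) *: im_vec Y + s *: im_vec Y'.
  apply/matrixP => i j; rewrite !mxE; case: (Y i j) (Y' i j) => p q [p' q'] /=.
  by ring.
rewrite -im_u in us0.
case: (image_eq_or_conj (u s)) => gE.
  by rewrite gt_eqF // im_correlation_id.
by rewrite lt_eqF // im_correlation_conj.
Qed.

(** Each non-real [Y] is joined to [Z ord_max] through non-real points. The path goes through
    [Z ord0] unless the segment to it meets a real point; in that case [im_vec Y] is a multiple of
    the first basis vector, and the direct segment works. *)
Lemma image_eq_or_conj_uniform : (forall Y, g Y = Y) \/ (forall Y, g Y = conj_vec Y).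
Proof.
pose Z (j : 'I_m.+2) : V := 'i *: delta_mx j 0.
have imZ j : im_vec (Z j) = delta_mx j 0.
  apply/matrixP => k l; rewrite !mxE; case: (_ && _); first by rewrite mulr1.
  by rewrite mulr0.
have max0 : (ord_max == ord0 :> 'I_m.+2) = false by [].
have corr Y : im_vec Y != 0 ->
    (0 < im_correlation Y) = (0 < im_correlation (Z ord_max)).
  move=> Y0.
  have ZZ : (0 < im_correlation (Z ord0)) = (0 < im_correlation (Z ord_max)).
    apply: im_correlation_segment => s _; rewrite !imZ; apply/eqP => /matrixP H.
    have := H ord0 0; have := H ord_max 0.
    rewrite !mxE !eqxx /= !mulr0 !mulr1 add0r addr0 => ->.
    by rewrite subr0 => /eqP; rewrite oner_eq0.
  have [H|] := pselect (forall s : R, 0 <= s <= 1 ->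
      (1 - s) *: im_vec Y + s *: im_vec (Z ord0) != 0).
    by rewrite (im_correlation_segment H).
  move=> /existsNP[s] /not_implyP[_ /negP]; rewrite negbK imZ => /eqP H.
  apply: im_correlation_segment => r _; rewrite imZ; apply/eqP => H'.
  have s1 : 1 - s != 0.
    apply/eqP => s1; move/matrixP/(_ ord0 0): H; rewrite s1 scale0r add0r !mxE.
    rewrite !eqxx mulr1 => s0; move/eqP: s1; rewrite s0 subr0.
    by rewrite oner_eq0.
  have Ymax : im_vec Y ord_max 0 = 0.
    move/matrixP/(_ ord_max 0): H; rewrite !mxE max0 mulr0 addr0.
    by move/eqP; rewrite mulf_eq0 (negPf s1) => /eqP.
  have r0 : r = 0.
    move/matrixP/(_ ord_max 0): H'; move: Ymax; rewrite !mxE !eqxx mulr1 => ->.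
    by rewrite mulr0 add0r.
  by move: H'; rewrite r0 subr0 scale1r scale0r addr0 => /eqP; rewrite (negPf Y0).
have real_case Y : im_vec Y = 0 -> g Y = Y /\ conj_vec Y = Y.
  move=> Y0; have YE : Y = real_vec (re_vec Y).
    by rewrite [LHS]vec_re_im Y0 /real_vec map_mx0 scaler0 addr0.
  split; first by rewrite YE g_real.
  by rewrite conj_vecE Y0 /real_vec map_mx0 scaler0 subr0 -/(real_vec _) -YE.
have [pos|neg] := boolP (0 < im_correlation (Z ord_max)); [left|right] => Y.
  have [/real_case[]//|Y0] := eqVneq (im_vec Y) 0.
  have [//|gE] := image_eq_or_conj Y.
  by have := im_correlation_conj Y0 gE; rewrite ltNge ltW // corr.
have [/real_case[-> ->]//|Y0] := eqVneq (im_vec Y) 0.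
have [gE|//] := image_eq_or_conj Y.
by move: neg; rewrite -(corr Y) // im_correlation_id.
Qed.

End Conjugation.

Theorem theorem4 (R : realType) (n : nat) (f : 'cV[C R]_n -> 'cV[C R]_n)
    (hn : (2 <= n)%N) (f_continuous : continuous f)
    (f_unit : preserves_unit_distance f) :
  exists (rho : C R -> C R) (I : 'cV[C R]_n -> 'cV[C R]_n),
    [/\ rho = id \/ rho = @tau R,
        affine_orthogonal I
      & f = I \o coordinatewise rho].
Proof.
case: n hn f f_continuous f_unit => [|[|m]] // _ f fc fu.
have [L [b [g [hL fE gc gu g_real]]]] := real_frame fc fu.
have LI : affine_orthogonal (fun X => L *m X + b) by exists L, b.
have [gE|gE] := image_eq_or_conj_uniform gc gu g_real.
  exists id, (fun X => L *m X + b); split; [by left|exact: LI|].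
  by apply/funext => X; rewrite /= fE gE /coordinatewise map_mx_id.
exists (@tau R), (fun X => L *m X + b); split; [by right|exact: LI|].
by apply/funext => X; rewrite /= fE gE.
Qed.
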